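(* Let $(Z(t),\mathcal F(t))_{t\ge0}$ be a centered square integrable martingale, left-continuous in $L^2(\mathbf P)$, with $Z(0)=0$ and $\mathcal F(0)$ trivial, and let $\nu$ be the Borel measure on $[0,\infty)$ with $\nu([a,c))=\mathbf{Var}(Z(c)-Z(a))$. Suppose that for some $q\in(0,\infty]$ $$\|Z\|_{\mathrm{Lip}(q),\nu}:=\sup\Big\{\frac{\|Z(c)-Z(a)\|_q}{\sqrt{\nu([a,c))}}:0\le a<c<\infty,\ \nu([a,c))\in(0,\infty)\Big\}<\infty.$$ Then there is $C(q)\in(0,\infty)$ such that for every $b\in L^2([0,\infty),\nu)$, $$\Big\|\int_{[0,\infty)}b(t)\,dZ(t)\Big\|_{2q/(q+2)}\le C(q)\,\|b\|_{L^2(\nu)}\,\|Z\|_{\mathrm{Lip}(q),\nu}$$ (for $q=\infty$, $2q/(q+2)$ is read as $2$).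
   Context: $|\eta|_p=(\mathbf E|\eta|^p)^{1/p}$; for $r\in(0,\infty]$, $\|\eta\|_r=\sup_{k\ge1\text{ integer}}|\eta|_k\,k^{-1/r}$. The stochastic integral $\int b\,dZ$ is defined for step functions $b=\sum_{k=0}^K b_k\mathbf 1_{[t_k,t_{k+1})}$ ($0\le t_0<\dots<t_{K+1}<\infty$, non-random) by $\sum_k b_k(Z(t_{k+1})-Z(t_k))$ and extended to $L^2(\nu)$ by the isometry $\mathbf E(\int b\,dZ)^2=\|b\|_{L^2(\nu)}^2$. *)

(* Defs.v *)
From HB Require Import structures.
From mathcomp Require Import all_boot all_order all_algebra.
From mathcomp Require Import all_classical all_reals all_analysis.
Set Implicit Arguments. Unset Strict Implicit. Unset Printing Implicit Defensive.
Import Order.TTheory GRing.Theory Num.Theory.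
Import numFieldNormedType.Exports.
Local Open Scope classical_set_scope.
Local Open Scope ring_scope.

Section defs.
Context {R : realType}.

Definition psi_weight (r : \bar R) (k : nat) : R :=
  match r with
  | r'%:E => powR k%:R (- r'^-1)
  | _ => 1
  end.

Definition psi_norm d (T : measurableType d) (P : probability T R)
    (r : \bar R) (eta : T -> R) : \bar R :=
  ereal_sup [set ('N[P]_(k%:R%:E)[EFin \o eta] * (psi_weight r k)%:E)%E
            | k in [set k : nat | (1 <= k)%N]].

Definition lip_expo (q : \bar R) : \bar R :=
  match q with
  | q'%:E => (2 * q' / (q' + 2))%:E
  | _ => 2%:E
  end.

Definition is_filtration d (T : measurableType d) (F : R -> set (set T)) :=
  (forall t, 0 <= t -> sigma_algebra setT (F t)) /\
  (forall t, 0 <= t -> F t `<=` measurable) /\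
  (forall s t, 0 <= s -> s <= t -> F s `<=` F t).

(* (Z(t), F(t))_{t>=0} is a centered square integrable martingale;
   the martingale property E[Z(t) | F(s)] = Z(s) is written out as
   E[(Z(t) - Z(s)) 1_A] = 0 for every A in F(s), together with adaptedness. *)
Definition centered_L2_martingale d (T : measurableType d) (P : probability T R)
    (F : R -> set (set T)) (Z : R -> T -> R) :=
  is_filtration F /\
  (forall t, 0 <= t -> forall B : set R, measurable B -> F t (Z t @^-1` B)) /\
  (forall t, 0 <= t -> Z t \in Lfun P 2%:E) /\
  (forall t, 0 <= t -> ('E_P[Z t] = 0)%E) /\
  (forall s t, 0 <= s -> s <= t -> forall A, F s A ->
      (\int[P]_(x in A) (Z t x - Z s x)%:E = 0)%E).

Definition L2_left_continuous d (T : measurableType d) (P : probability T R)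
    (Z : R -> T -> R) :=
  forall t, 0 < t ->
    (fun s => ('E_P[(fun x => ((Z t x - Z s x) ^+ 2)%R)])%E) @ t^'- --> 0%E.

(* ||Z||_{Lip(q),nu}; the supremum of the empty family is taken to be 0
   (all members of the family are nonnegative) *)
Definition lip_norm d (T : measurableType d) (P : probability T R)
    (nu : {measure set R -> \bar R}) (q : \bar R) (Z : R -> T -> R) : \bar R :=
  ereal_sup (0%E |` [set y | exists a c, [/\ 0 <= a, a < c,
      (0 < nu [set` `[a, c[])%E, (nu [set` `[a, c[] < +oo)%E &
      y = (psi_norm P q (fun x => (Z c x - Z a x)%R) *
           ((Num.sqrt (fine (nu [set` `[a, c[])))^-1)%:E)%E]]).

Definition valid_times (K : nat) (tm : nat -> R) :=
  0 <= tm 0%N /\ forall k, (k <= K)%N -> tm k < tm k.+1.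

Definition step_fun (K : nat) (tm : nat -> R) (bv : nat -> R) : R -> R :=
  fun s => \sum_(k < K.+1) bv k * \1_([set` `[tm k, tm k.+1[]) s.

Definition step_int {T : Type} (Z : R -> T -> R) (K : nat) (tm : nat -> R)
    (bv : nat -> R) : T -> R :=
  fun x => \sum_(k < K.+1) bv k * (Z (tm k.+1) x - Z (tm k) x).

(* X is (a version of) the stochastic integral int b dZ, i.e. the value at b of
   the isometric extension to L^2(nu) of the integral on step functions:
   X is the L^2(P)-limit of the integrals of step functions converging to b
   in L^2(nu). *)
Definition is_stoch_integral d (T : measurableType d) (P : probability T R)
    (nu : {measure set R -> \bar R}) (Z : R -> T -> R) (b : R -> R)
    (X : T -> R) :=
  X \in Lfun P 2%:E /\
  exists (K : nat -> nat) (tm bv : nat -> nat -> R),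
    (forall n, valid_times (K n) (tm n)) /\
    (fun n => ('N[nu]_2%:E[EFin \o (b \- step_fun (K n) (tm n) (bv n))%R])%E) @ \oo
      --> 0%E /\
    (fun n => ('N[P]_2%:E[EFin \o (X \- step_int Z (K n) (tm n) (bv n))%R])%E) @ \oo
      --> 0%E.

End defs.

(* Main.v *)
(* For a martingale difference Y after X and an even exponent 2m, the convexity
   bound (x - y)^2m >= x^2m - 2m x^(2m-1) y cancels the odd terms of (x + y)^2m
   and gives pointwise
     (x + y)^2m - 2m x^(2m-1) y <= (x^2 + 4m y^2)^m.
   The linear term has mean zero, so Minkowski's inequality in L^m yields
     |X + Y|_2m^2 <= |X|_2m^2 + 4m |Y|_2m^2.
   By induction, an integral of a step function b satisfies
     |int b dZ|_2m <= 2 sqrt(m) (sum_k b_k^2 |Z(t_(k+1)) - Z(t_k)|_2m^2)^(1/2)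
                   <= 2 sqrt(m) (2m)^(1/q) |b|_2 |Z|_Lip,
   where k^(1/2 + 1/q) = k^((q + 2) / (2q)) is the growth to be proved. Moments
   are lower semicontinuous under L^2 limits, and |.|_k <= |.|_2k passes from
   even to arbitrary integer exponents. *)
Require Import Defs.
From HB Require Import structures.
From mathcomp Require Import all_boot all_order all_algebra.
From mathcomp Require Import all_classical all_reals all_analysis.
From mathcomp Require Import measurable_realfun.
From mathcomp Require Import ring lra.
Set Implicit Arguments. Unset Strict Implicit. Unset Printing Implicit Defensive.
Import Order.TTheory GRing.Theory Num.Theory.
Import numFieldNormedType.Exports.
Local Open Scope classical_set_scope.
Local Open Scope ring_scope.

(** * Binomial coefficients and inequalities for even powers *)

(** Going from i to i + 1 multiplies C(2m,2i) by (m-i)/(i+1), which is exactly the growth of C(m,i),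
    times (2m-2i-1)/(2i+1), which is at most 2m. *)
Lemma bin_double_le (m i : nat) : ('C(m.*2, i.*2) <= 'C(m, i) * m.*2 ^ i)%N.
Proof.
elim: i => [|i IHi]; first by rewrite !bin0.
have [mi|im] := leqP m i.
  by rewrite (@bin_small m.*2) // ltn_double ltnS.
have e1 := mul_bin_left m.*2 i.*2.
have e2 := mul_bin_left m.*2 i.*2.+1.
have e3 := mul_bin_left m i.
rewrite doubleS expnS.
move: e1 e2 e3 IHi.
set a := 'C(m.*2, i.*2); set b := 'C(_, i.*2.+1); set c := 'C(_, i.*2.+2).
set u := 'C(m, i); set v := 'C(m, i.+1); set w := (_ ^ i)%N => e1 e2 e3 IHi.
have h : (i.*2.+2 * (i.*2.+1 * c) <= i.*2.+2 * ((m.*2 - i.*2.+1) * (v * w)))%N.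
  rewrite mulnCA e2 mulnCA e1 mulnA mulnA -[X in (X * _ <= _)%N]mulnC mulnC.
  rewrite -doubleS -doubleB -!muln2.
  rewrite [X in (_ <= X)%N](_ : _ = (m - i) * 2 * (m * 2 - (i * 2).+1) * (u * w))%N; last first.
    by transitivity ((i.+1 * v) * 2 * (m * 2 - (i * 2).+1) * w)%N; [ring|rewrite e3; ring].
  by rewrite mulnC; apply: leq_mul; first by [].
rewrite leq_pmul2l // in h.
have h1 : (c <= i.*2.+1 * c)%N by rewrite leq_pmull.
apply: (leq_trans h1); apply: (leq_trans h).
rewrite mulnCA leq_mul2l leq_mul2r; apply/orP; right; apply/orP; right; exact: leq_subr.
Qed.

Lemma sum_double (V : nmodType) (F : nat -> V) m :
  (forall i, odd i -> F i = 0) ->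
  \sum_(i < m.*2.+1) F i = \sum_(i < m.+1) F i.*2.
Proof.
move=> F0; elim: m => [|m IHm]; first by rewrite !big_ord1.
rewrite doubleS 2!big_ord_recr /= IHm [RHS]big_ord_recr /= F0 ?addr0 //.
by rewrite /= odd_double.
Qed.

Section even_powers.
Variable R : realFieldType.
Implicit Types x y z : R.

(** Convexity without derivatives: the gap for m + 1 is (z^2 - x^2)(z^2m - x^2m) + x^2m (z - x)^2 +
    x^2 times the gap for m, a sum of nonnegative terms. *)
Lemma even_power_tangent x z m :
  x ^+ m.*2 + m.*2%:R * x ^+ m.*2.-1 * (z - x) <= z ^+ m.*2.
Proof.
elim: m => [|m IHm]; first by rewrite !expr0 mul0r mul0r addr0.
have mono : 0 <= (z ^+ 2 - x ^+ 2) * (z ^+ m.*2 - x ^+ m.*2).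
  rewrite -mul2n !exprM.
  have [zx|xz] := lerP (x ^+ 2) (z ^+ 2).
    by rewrite mulr_ge0 // subr_ge0 // lerXn2r // nnegrE sqr_ge0.
  have zx := ltW xz.
  by rewrite mulr_le0 // subr_le0 // lerXn2r // nnegrE sqr_ge0.
have sq : 0 <= x ^+ m.*2 * (z - x) ^+ 2.
  by rewrite mulr_ge0 ?sqr_ge0 // -mul2n exprM exprn_ge0 // sqr_ge0.
have IH2 : 0 <= x ^+ 2 * (z ^+ m.*2 - (x ^+ m.*2 + m.*2%:R * x ^+ m.*2.-1 * (z - x))).
  by rewrite mulr_ge0 ?sqr_ge0 // subr_ge0.
rewrite -subr_ge0 doubleS /=.
apply: le_trans (addr_ge0 (addr_ge0 mono sq) IH2) _.
rewrite le_eqVlt; apply/orP; left; apply/eqP.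
(* The predecessor in [m.*2.-1] truncates at m = 0, so the polynomial identity is checked there
   separately. *)
case: m {IHm mono sq IH2} => [|m]; first by rewrite double0 /= !expr0 mul0r expr1; ring.
rewrite doubleS /= !exprS -!natr1; ring.
Qed.

Lemma even_power_add_le x y m :
  (x + y) ^+ m.*2 <=
  (x ^+ 2 + 2 * m.*2%:R * y ^+ 2) ^+ m + m.*2%:R * x ^+ m.*2.-1 * y.
Proof.
have tangent := even_power_tangent x (x - y) m.
have -> : (x + y) ^+ m.*2 = ((x + y) ^+ m.*2 + (x - y) ^+ m.*2) - (x - y) ^+ m.*2.
  by rewrite addrK.
(* The tangent bound at x towards x - y controls -(x - y)^2m. What remains is symmetric in y, so
   only even powers of y survive, each counted twice. *)
suff : (x + y) ^+ m.*2 + (x - y) ^+ m.*2 <=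
       (x ^+ 2 + 2 * m.*2%:R * y ^+ 2) ^+ m + x ^+ m.*2 by lra.
rewrite !exprDn -big_split /=.
rewrite (@sum_double R (fun i => x ^+ (m.*2 - i) * y ^+ i *+ 'C(m.*2, i)
                        + x ^+ (m.*2 - i) * (- y) ^+ i *+ 'C(m.*2, i))); last first.
  by move=> i oi; rewrite exprNn -signr_odd oi expr1 mulN1r mulrN mulNrn addrN.
(* The term of index 0 is 2 x^2m: one copy matches the leading term of the m-th power, the other the
   extra x^2m. Only indices k >= 1 are left. *)
rewrite !big_ord_recl /= !double0 !subn0 !bin0 !expr0 !mulr1 !mulr1n.
rewrite -mul2n exprM mul2n [leRHS]addrAC lerD2l; apply: ler_sum => i _.
have : (0 < bump 0 i)%N by rewrite /bump leq0n.
move: (bump 0 i) => k k0.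
have -> : x ^+ (m.*2 - k.*2) = x ^+ 2 ^+ (m - k) by rewrite -doubleB -mul2n exprM.
have sqX z : z ^+ k.*2 = z ^+ 2 ^+ k by rewrite -mul2n exprM.
rewrite !sqX sqrrN -mulr2n -mulrnA [(_ * y ^+ 2) ^+ k]exprMn.
move: (x ^+ 2 ^+ (m - k)) (y ^+ 2 ^+ k)
  (exprn_ge0 (m - k) (sqr_ge0 x)) (exprn_ge0 k (sqr_ge0 y)) => a b a0 b0.
rewrite [leRHS](_ : _ = a * b * ('C(m, k) * (2 * m.*2) ^ k)%:R); last first.
  rewrite natrM natrX natrM -[LHS]mulr_natr.
  by rewrite -!mulrA; congr (a * _); rewrite mulrC -mulrA.
rewrite -[leLHS]mulr_natr; apply: ler_wpM2l.
  by rewrite mulr_ge0.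
(* The chain is 2 C(2m,2k) <= 2 C(m,k) (2m)^k <= C(m,k) (4m)^k, the last inequality because 2 <= 2^k
   for k >= 1. *)
rewrite ler_nat.
apply: (@leq_trans ('C(m, k) * m.*2 ^ k * 2)).
  by rewrite leq_mul2r bin_double_le.
rewrite expnMn -mulnA leq_mul2l; apply/orP; right.
by rewrite mulnC leq_mul2r -{1}(expn1 2) leq_exp2l // k0 orbT.
Qed.

End even_powers.

(** * Time grids and measurability *)

Lemma increasing_times_le (R : realFieldType) (tm : nat -> R) n :
  (forall k, (k < n)%N -> tm k < tm k.+1) ->
  forall i j, (i <= j <= n)%N -> tm i <= tm j.
Proof.
move=> ht i j /andP[ij jn]; elim: j ij jn => [|j IHj].
  by rewrite leqn0 => /eqP ->.
rewrite leq_eqVlt => /predU1P[-> //|]; rewrite ltnS => ij jn.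
by apply: le_trans (IHj ij (ltnW jn)) _; exact/ltW/ht.
Qed.

Lemma measurable_fun_Lfun d (T : measurableType d) (R : realType)
    (mu : {measure set T -> \bar R}) (f : T -> R) p :
  f \in Lfun mu p -> measurable_fun setT f.
Proof. by rewrite inE => /andP[+ _]; rewrite inE. Qed.

(** Turns adaptedness, given through preimages, into measurability on the type generated by [G], so
    that sums of adapted variables follow from the usual closure rules. *)
Lemma preimage_measurable_fun d (T : measurableType d) (R : realType)
    (G : set (set T)) (f : T -> R) :
  sigma_algebra setT G ->
  (forall B : set R, measurable B -> G (f @^-1` B)) ->
  measurable_fun (setT : set (g_sigma_algebraType G)) (f : g_sigma_algebraType G -> R).
Proof.
move=> sG h _ B mB; rewrite setTI.
by apply: sub_sigma_algebra; exact: h.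
Qed.

(** * Norms and integer moments *)

Section nat_moments.
Context d (T : measurableType d) (R : realType) (mu : {measure set T -> \bar R}).
Implicit Types f : T -> R.

(** Powers with exponents k and 1/k are monotone on [0, +oo], so infinite values are covered too.
    This allows estimates to be carried out on integrals. *)
Lemma Lnorm_nat_le f k (c : R) : (0 < k)%N -> 0 <= c ->
  ('N[mu]_(k%:R%:E)[EFin \o f] <= c%:E)%E =
  (\int[mu]_x (`|f x| ^+ k)%:E <= (c ^+ k)%:E)%E.
Proof.
move=> k0 c0.
have kR0 : (0 : R) < k%:R by rewrite ltr0n.
have <- : ('N[mu]_(k%:R%:E)[EFin \o f] `^ k%:R = \int[mu]_x (`|f x| ^+ k)%:E)%E.
  rewrite poweR_Lnorm ?gt_eqF //; apply: eq_integral => x _ /=.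
  by rewrite powR_mulrn.
rewrite -powR_mulrn // -poweR_EFin.
have N0 := Lnorm_ge0 mu k%:R%:E (EFin \o f).
apply/idP/idP => h.
  by apply: gt0_ler_poweR; rewrite ?in_itv /= ?leey ?andbT ?lee_fin // ltW.
have ki0 : (0 : R) <= k%:R^-1 by rewrite invr_ge0 ltW.
have := @gt0_ler_poweR _ _ ki0 _ _ _ _ h.
rewrite -!poweRrM mulfV ?gt_eqF // !poweRe1 ?lee_fin //; apply.
  by rewrite in_itv /= leey andbT poweR_ge0.
by rewrite in_itv /= leey andbT lee_fin powR_ge0.
Qed.

End nat_moments.

(** Hölder's inequality against the constant 1, which has norm 1 under a probability. *)
Lemma Lnorm1_le2 d (T : measurableType d) (R : realType)
    (P : probability T R) (f : T -> R) : measurable_fun setT f ->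
  ('N[P]_1[EFin \o f] <= 'N[P]_2%:E[EFin \o f])%E.
Proof.
move=> mf.
have := @hoelder _ _ _ P f (cst 1) 2 2 mf (measurable_cst _).
rewrite !ltr0n => /(_ isT isT).
have -> : (2^-1 + 2^-1 = 1 :> R) by lra.
move=> /(_ erefl).
have -> : ('N[P]_2[EFin \o cst 1%R] = 1)%E.
  rewrite (@Lnorm_cst1 _ _ _ P 2) -[RHS](poweR1r 2^-1); congr (_ `^ _)%E.
  exact: probability_setT.
rewrite mule1; apply: le_trans; rewrite le_eqVlt; apply/orP; left; apply/eqP.
by apply: eq_Lnorm => x /=; rewrite mulr1.
Qed.

(** The comparison of first and second norms, applied to |f|^k, gives |f|_k <= |f|_2k; [B] bounds
    the square of the latter. *)
Lemma Lnorm_nat_double d (T : measurableType d) (R : realType) (P : probability T R)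
    (f : T -> R) k (B : R) :
  measurable_fun setT f -> (0 < k)%N -> 0 <= B ->
  (\int[P]_x (f x ^+ k.*2)%:E <= (B ^+ k)%:E)%E ->
  ('N[P]_(k%:R%:E)[EFin \o f] <= (Num.sqrt B)%:E)%E.
Proof.
move=> mf k0 B0 h.
rewrite Lnorm_nat_le ?sqrtr_ge0 //.
have mg : measurable_fun setT (fun x => `|f x| ^+ k).
  by apply: measurable_funX; exact: measurableT_comp.
have := Lnorm1_le2 P mg; rewrite Lnorm1.
under eq_integral do rewrite /= ger0_norm ?exprn_ge0 //.
move=> /le_trans; apply.
rewrite (@Lnorm_nat_le _ _ _ P _ 2) ?exprn_ge0 ?sqrtr_ge0 //.
rewrite -exprM mulnC exprM sqr_sqrtr //.
apply: le_trans h; rewrite le_eqVlt; apply/orP; left; apply/eqP.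
apply: eq_integral => x _; congr EFin.
by rewrite ger0_norm ?exprn_ge0 // -exprM mulnC exprM real_normK ?num_real // -exprM mul2n.
Qed.

(** * Orthogonality of a martingale difference to functions of the past *)

Section orthogonality.
Import HBNNSimple.
Context d (T : measurableType d) (R : realType) (mu : {measure set T -> \bar R}).
Variables (W Y : T -> R).
Hypotheses (mW : measurable_fun setT W) (iY : mu.-integrable setT (EFin \o Y)).
Hypothesis YW0 : forall B : set R, measurable B ->
  (\int[mu]_(x in W @^-1` B) (Y x)%:E = 0)%E.

Let mY : measurable_fun setT Y.
Proof. by apply/measurable_EFinP; exact: measurable_int iY. Qed.

Let integral_indic_comp_mul (B : set R) : measurable B ->
  (\int[mu]_x (\1_B (W x) * Y x)%:E = 0)%E.
Proof.
move=> mB; rewrite -(YW0 mB) [RHS]integral_mkcond; apply: eq_integral => x _.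
rewrite patchE indicE [in RHS](_ : (x \in W @^-1` B) = (W x \in B)).
  by case: ifPn => _; rewrite ?mul1r ?mul0r.
by [].
Qed.

Let integrable_indic_comp_mul (a : R) (B : set R) : measurable B ->
  mu.-integrable setT (fun x => (a * \1_B (W x) * Y x)%:E).
Proof.
move=> mB.
apply: (@le_integrable _ _ _ _ _ _ _ (fun x => `|a|%:E * (`|Y x|%:E))%E) => //.
- apply/measurable_EFinP; apply: measurable_funM => //.
  apply: measurable_funM => //.
  by apply: (measurableT_comp (measurable_indic mB) mW).
- move=> x _ /=; rewrite lee_fin !normrM !normr_id ler_wpM2r //.
  rewrite -[leRHS]mulr1 ler_wpM2l //.
  by rewrite indicE; case: (_ \in _); rewrite ?normr1 ?normr0.
- by apply: integrableZl => //; exact: integrable_norm.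
Qed.

Let integral_nneg_comp_mul (g : R -> R) : measurable_fun setT g ->
  (forall x, 0 <= g x) ->
  mu.-integrable setT (fun x => (g (W x) * Y x)%:E) ->
  (\int[mu]_x (g (W x) * Y x)%:E = 0)%E.
Proof.
move=> mg g0 igY.
have mf : measurable_fun setT (EFin \o g) by apply/measurable_EFinP.
(* Simple functions increase to g. For each of them the integral is a finite combination of
   integrals of Y over preimages under W, hence zero. *)
pose h := nnsfun_approx measurableT mf.
have hg y : (EFin \o h^~ y) @ \oo --> (g y)%:E.
  by apply: (@cvg_nnsfun_approx _ _ _ _ measurableT _ mf) => // x _; rewrite lee_fin.
have h_le n y : h n y <= g y.
  rewrite -lee_fin.
  have nd : {homo (fun k => (h k y)%:E) : i j / (i <= j)%N >-> (i <= j)%E}.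
    move=> i j ij; rewrite lee_fin.
    exact: (lefP _ _ (nd_nnsfun_approx measurableT mf ij)).
  have -> : (g y)%:E = ereal_sup (range (fun k => (h k y)%:E)).
    rewrite -(cvg_lim _ (hg y)) //; apply/cvg_lim => //.
    exact: ereal_nondecreasing_cvgn.
  by apply: ereal_sup_ubound; exists n.
have intn n : (\int[mu]_x (h n (W x) * Y x)%:E = 0)%E.
  under eq_integral do rewrite fimfunE fsbig_finite //= mulr_suml -sumEFin.
  rewrite integral_sum //=; last first.
    by move=> y; exact: integrable_indic_comp_mul.
  rewrite big1 // => y _.
  under eq_integral do rewrite -mulrA EFinM.
  rewrite integralZl //.
    by rewrite integral_indic_comp_mul ?mule0.
  have := @integrable_indic_comp_mul 1 (h n @^-1` [set y]).
  under eq_fun do rewrite mul1r.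
  exact.
(* Since 0 <= h n <= g, the function |g(W) Y| itself dominates. *)
have [] := @dominated_convergence _ _ _ mu _ measurableT
  (fun n x => (h n (W x) * Y x)%:E) (fun x => (g (W x) * Y x)%:E)
  (fun x => `|(g (W x) * Y x)%:E|%E).
- move=> n; apply/measurable_EFinP; apply: measurable_funM => //.
  exact: (measurableT_comp _ mW).
- apply/measurable_EFinP; apply: measurable_funM => //.
  exact: (measurableT_comp _ mW).
- apply/aeW => x _.
  under eq_fun do rewrite EFinM.
  rewrite EFinM; apply: cvgeM => //; [exact: hg|exact: cvg_cst].
- exact: (integrable_abse igY).
- apply/aeW => x n _; rewrite lee_fin !normrM ler_wpM2r //.
  by rewrite !ger0_norm.
move=> _ _.
under eq_fun do rewrite intn.
move=> /cvg_lim <- //; exact: lim_cst.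
Qed.

(** The positive and negative parts of g are treated separately; both products stay integrable
    because they are dominated by |g(W) Y|. *)
Lemma integral_comp_mul_eq0 (g : R -> R) : measurable_fun setT g ->
  mu.-integrable setT (fun x => (g (W x) * Y x)%:E) ->
  (\int[mu]_x (g (W x) * Y x)%:E = 0)%E.
Proof.
move=> mg igY.
have split_g x : g (W x) * Y x = Num.max (g (W x)) 0 * Y x + - (Num.max (- g (W x)) 0 * Y x).
  rewrite -mulNr -mulrDl; congr (_ * _).
  by case: (lerP 0 (g (W x))); rewrite /Num.max; case: ltP => ?; case: ltP => ?; lra.
have mgp : measurable_fun setT (fun x => Num.max (g x) 0).
  exact: measurable_funrpos.
have mgn : measurable_fun setT (fun x => Num.max (- g x) 0).
  exact: measurable_funrneg.
have igp : mu.-integrable setT (fun x => (Num.max (g (W x)) 0 * Y x)%:E).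
  apply: le_integrable igY => //.
    apply/measurable_EFinP; apply: measurable_funM => //.
    exact: (measurableT_comp mgp mW).
  move=> x _; rewrite lee_fin !normrM ler_wpM2r //.
  by rewrite ger0_norm ?le_max ?lexx ?orbT // ge_max ler_norm normr_ge0.
have ign : mu.-integrable setT (fun x => (Num.max (- g (W x)) 0 * Y x)%:E).
  apply: le_integrable igY => //.
    apply/measurable_EFinP; apply: measurable_funM => //.
    exact: (measurableT_comp mgn mW).
  move=> x _; rewrite lee_fin !normrM ler_wpM2r //.
  by rewrite ger0_norm ?le_max ?lexx ?orbT // ge_max normr_ge0 andbT -normrN ler_norm.
under eq_integral do rewrite split_g EFinD EFinN.
rewrite integralB_EFin //.
rewrite (@integral_nneg_comp_mul (fun x => Num.max (g x) 0)) //; last first.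
  by move=> x; rewrite le_max lexx orbT.
rewrite (@integral_nneg_comp_mul (fun x => Num.max (- g x) 0)) ?sube0 //.
by move=> x; rewrite le_max lexx orbT.
Qed.

End orthogonality.

(** * Even moments of a sum with an orthogonal increment *)

Lemma sqrX_double (R : pzRingType) (x : R) m : (x ^+ 2) ^+ m = x ^+ m.*2.
Proof. by rewrite -exprM mul2n. Qed.

Lemma even_power_ge0 (R : realDomainType) (x : R) m : 0 <= x ^+ m.*2.
Proof. by rewrite -sqrX_double exprn_ge0 // sqr_ge0. Qed.

Lemma norm_even_power (R : realDomainType) (x : R) m : `|x| ^+ m.*2 = x ^+ m.*2.
Proof. by rewrite -normrX ger0_norm // even_power_ge0. Qed.

(** Both factors are bounded by the larger of |x| and |y|. This makes the linear correction term
    integrable as soon as the moments of order 2m are finite. *)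
Lemma normM_even_power_le (R : realDomainType) (x y : R) m : (0 < m)%N ->
  `|x ^+ m.*2.-1 * y| <= x ^+ m.*2 + y ^+ m.*2.
Proof.
move=> m0; rewrite normrM normrX -(norm_even_power x) -(norm_even_power y).
have e : m.*2 = m.*2.-1.+1 by rewrite prednK // double_gt0.
have [xy|yx] := lerP `|x| `|y|.
  apply: (@le_trans _ _ (`|y| ^+ m.*2)); last by rewrite lerDr exprn_ge0.
  by rewrite [in leRHS]e exprSr ler_wpM2r // lerXn2r.
apply: (@le_trans _ _ (`|x| ^+ m.*2)); last by rewrite lerDl exprn_ge0.
by rewrite [in leRHS]e exprSr ler_wpM2l // ?exprn_ge0 // ltW.
Qed.

Section moment_step.
Context d (T : measurableType d) (R : realType) (mu : {measure set T -> \bar R}).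

Lemma integrable_even_power (X : T -> R) m (a : R) : measurable_fun setT X ->
  (\int[mu]_x (X x ^+ m.*2)%:E <= a%:E)%E ->
  mu.-integrable setT (fun x => (X x ^+ m.*2)%:E).
Proof.
move=> mX h; apply/integrableP; split.
  by apply/measurable_EFinP; exact: measurable_funX.
under eq_integral do rewrite gee0_abs ?lee_fin ?even_power_ge0 //.
by apply: le_lt_trans h _; rewrite ltry.
Qed.

Lemma even_moment_scale (Y : T -> R) m (c b : R) : measurable_fun setT Y ->
  (\int[mu]_x (Y x ^+ m.*2)%:E <= (b ^+ m)%:E)%E ->
  (\int[mu]_x ((c * Y x) ^+ m.*2)%:E <= ((c ^+ 2 * b) ^+ m)%:E)%E.
Proof.
move=> mY h.
under eq_integral do rewrite exprMn EFinM.
rewrite ge0_integralZl_EFin //.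
- by rewrite exprMn sqrX_double EFinM lee_wpmul2l // lee_fin even_power_ge0.
- by move=> x _; rewrite lee_fin even_power_ge0.
- by apply/measurable_EFinP; exact: measurable_funX.
- exact: even_power_ge0.
Qed.

(** One step of the recursion. Writing the bounds as m-th powers makes [a] and [b] bounds for the
    squared norms of order 2m, which then add up linearly. *)
Lemma even_moment_add_le (X Y : T -> R) m (a b : R) :
  (0 < m)%N -> measurable_fun setT X -> mu.-integrable setT (EFin \o Y) ->
  0 <= a -> 0 <= b ->
  (\int[mu]_x (X x ^+ m.*2)%:E <= (a ^+ m)%:E)%E ->
  (\int[mu]_x (Y x ^+ m.*2)%:E <= (b ^+ m)%:E)%E ->
  (forall B : set R, measurable B -> (\int[mu]_(x in X @^-1` B) (Y x)%:E = 0)%E) ->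
  (\int[mu]_x ((X x + Y x) ^+ m.*2)%:E <= ((a + 2 * m.*2%:R * b) ^+ m)%:E)%E.
Proof.
move=> m0 mX iY a0 b0 hX hY YX0.
have mY : measurable_fun setT Y.
  by apply/measurable_EFinP; exact: measurable_int iY.
have iX2 := integrable_even_power mX hX.
have iY2 := integrable_even_power mY hY.
have mXY : measurable_fun setT (fun x => X x ^+ m.*2.-1 * Y x).
  by apply: measurable_funM => //; exact: measurable_funX.
have iXY : mu.-integrable setT (fun x => (X x ^+ m.*2.-1 * Y x)%:E).
  apply: le_integrable (integrableD measurableT iX2 iY2) => //.
    exact/measurable_EFinP.
  move=> x _ /=; rewrite lee_fin [leRHS]ger0_norm ?addr_ge0 ?even_power_ge0 //.
  exact: normM_even_power_le.
have XY0 : (\int[mu]_x (X x ^+ m.*2.-1 * Y x)%:E = 0)%E.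
  exact: (integral_comp_mul_eq0 mX iY YX0 (@exprn_measurable _ _ _)).
pose c : R := 2 * m.*2%:R.
have c0 : 0 <= c by rewrite /c mulr_ge0 ?ler0n.
pose V x := X x ^+ 2 + c * Y x ^+ 2.
have V0 x : 0 <= V x by apply: addr_ge0; [|apply: mulr_ge0 => //]; exact: sqr_ge0.
have mV : measurable_fun setT V.
  apply: measurable_funD; first exact: measurable_funX.
  by apply: measurable_funM => //; exact: measurable_funX.
(* Minkowski's inequality in L^m for the two nonnegative summands X^2 and c Y^2. *)
have hV : (\int[mu]_x (V x ^+ m)%:E <= ((a + c * b) ^+ m)%:E)%E.
  under eq_integral => x _ do rewrite -(ger0_norm (V0 x)).
  rewrite -Lnorm_nat_le ?addr_ge0 ?mulr_ge0 //.
  have m1 : 1 <= m%:R :> R by rewrite ler1n.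
  have mX2 : measurable_fun setT (fun x => X x ^+ 2) by exact: measurable_funX.
  have mY2 : measurable_fun setT (fun x => c * Y x ^+ 2).
    by apply: measurable_funM => //; exact: measurable_funX.
  apply: le_trans (minkowski_EFin mu mX2 mY2 m1) _.
  rewrite EFinD; apply: leeD; rewrite Lnorm_nat_le ?mulr_ge0 //.
    apply: le_trans hX; rewrite le_eqVlt; apply/orP; left; apply/eqP.
    by apply: eq_integral => x _; rewrite ger0_norm ?sqr_ge0 // sqrX_double.
  (* Writing c Y^2 as (sqrt c Y)^2 reduces the second summand to the scaling of an even moment. *)
  apply: le_trans (_ : (((Num.sqrt c) ^+ 2 * b) ^+ m)%:E <= _)%E; last by rewrite sqr_sqrtr.
  apply: le_trans (even_moment_scale (Num.sqrt c) mY hY).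
  rewrite le_eqVlt; apply/orP; left; apply/eqP.
  apply: eq_integral => x _; rewrite ger0_norm; last first.
    by apply: mulr_ge0 => //; exact: sqr_ge0.
  by rewrite -[in LHS](sqr_sqrtr c0) -exprMn sqrX_double.
have iV : mu.-integrable setT (fun x => (V x ^+ m)%:E).
  apply/integrableP; split.
    by apply/measurable_EFinP; exact: measurable_funX.
  under eq_integral => x _ do rewrite gee0_abs ?lee_fin ?exprn_ge0 //.
  by apply: le_lt_trans hV _; rewrite ltry.
have iR : mu.-integrable setT
    (fun x => ((V x ^+ m)%:E + m.*2%:R%:E * (X x ^+ m.*2.-1 * Y x)%:E)%E).
  by apply: integrableD => //; exact: integrableZl.
have pw x : (((X x + Y x) ^+ m.*2)%:E <=
    (V x ^+ m)%:E + m.*2%:R%:E * (X x ^+ m.*2.-1 * Y x)%:E)%E.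
  rewrite -EFinM -EFinD lee_fin mulrA.
  exact: even_power_add_le.
apply: le_trans (_ : _ <= \int[mu]_x ((V x ^+ m)%:E + m.*2%:R%:E * (X x ^+ m.*2.-1 * Y x)%:E))%E _.
  apply: ge0_le_integral => //.
  - by move=> x _; rewrite lee_fin even_power_ge0.
  - apply/measurable_EFinP; apply: measurable_funX; exact: measurable_funD.
  - exact: measurable_int iR.
rewrite integralD //; last exact: integrableZl.
by rewrite integralZl // XY0 mule0 adde0.
Qed.

End moment_step.

(** * Lower semicontinuity of even moments under L^2 limits *)

(** If the truncated value u exceeds |y|, the tangent at u towards |y| has slope at most 2m
    M^(2m-1), and u - |y| <= |x - y|. After truncation, closeness in L^1 therefore controls the
    moment. *)
Lemma truncated_power_le (R : realFieldType) (x y M : R) m : 0 <= M ->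
  Num.min `|x| M ^+ m.*2 <= y ^+ m.*2 + m.*2%:R * M ^+ m.*2.-1 * `|x - y|.
Proof.
move=> M0; set u := Num.min _ _.
have u0 : 0 <= u by rewrite le_min normr_ge0.
have [uy|yu] := lerP u `|y|.
  rewrite -(norm_even_power y); apply: le_trans (_ : `|y| ^+ m.*2 <= _).
    by rewrite lerXn2r // nnegrE.
  by rewrite lerDl !mulr_ge0 // exprn_ge0.
have := even_power_tangent u `|y| m; rewrite norm_even_power => h.
have {h} h : u ^+ m.*2 <= y ^+ m.*2 + m.*2%:R * u ^+ m.*2.-1 * (u - `|y|).
  by rewrite -lerBlDr -mulrN opprB.
apply: le_trans h _; rewrite lerD2l -!mulrA ler_wpM2l //.
apply: ler_pM; rewrite ?exprn_ge0 ?subr_ge0 ?(ltW yu) //.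
  by rewrite lerXn2r // ?nnegrE // ge_min lexx orbT.
apply: le_trans (lerB_dist _ _); rewrite lerD2r.
by rewrite ge_min lexx.
Qed.

Section moment_limit.
Context d (T : measurableType d) (R : realType) (P : probability T R).

(** No almost everywhere convergent subsequence is extracted: at a fixed truncation level j the
    error tends to 0 with the L^2 distance, and then j grows by monotone convergence. *)
Lemma even_moment_lim (X : T -> R) (I : nat -> T -> R) m (B : R) :
  measurable_fun setT X -> (forall n, measurable_fun setT (I n)) ->
  (fun n => 'N[P]_2%:E[EFin \o (X \- I n)%R])%E @ \oo --> 0%E ->
  (\forall n \near \oo, (\int[P]_x (I n x ^+ m.*2)%:E <= B%:E)%E) ->
  (\int[P]_x (X x ^+ m.*2)%:E <= B%:E)%E.
Proof.
move=> mX mI XI hI.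
pose t j x := (Num.min `|X x| j%:R ^+ m.*2)%:E : \bar R.
have mt j : measurable_fun setT (t j).
  apply/measurable_EFinP; apply: measurable_funX.
  by apply: measurable_minr => //; exact: measurableT_comp.
have t0 j x : (0 <= t j x)%E by rewrite lee_fin even_power_ge0.
have tB j : (\int[P]_x t j x <= B%:E)%E.
  pose K : R := m.*2%:R * j%:R ^+ m.*2.-1.
  have K0 : 0 <= K by rewrite mulr_ge0 ?exprn_ge0.
  have bnd : \forall n \near \oo,
      (\int[P]_x t j x <= B%:E + K%:E * 'N[P]_2%:E[EFin \o (X \- I n)%R])%E.
    apply: filterS hI => n hn.
    have mXI : measurable_fun setT (X \- I n) by exact: measurable_funB.
    apply: le_trans (_ : _ <=
        \int[P]_x ((I n x ^+ m.*2)%:E + K%:E * `|(X \- I n)%R x|%:E))%E _.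
      apply: ge0_le_integral => //.
      - apply: emeasurable_funD.
          by apply/measurable_EFinP; exact: measurable_funX.
        apply/measurable_EFinP; apply: measurable_funM => //.
        exact: measurableT_comp.
      - by move=> x _; rewrite -EFinM -EFinD lee_fin; exact: truncated_power_le.
    rewrite ge0_integralD //.
    - apply: leeD => //.
      rewrite ge0_integralZl_EFin //; last first.
        by apply/measurable_EFinP; exact: measurableT_comp.
      apply: lee_wpmul2l; first by rewrite lee_fin.
      apply: le_trans (Lnorm1_le2 P mXI).
      by rewrite Lnorm1.
    - by move=> x _; rewrite lee_fin even_power_ge0.
    - by apply/measurable_EFinP; exact: measurable_funX.
    - by move=> x _; rewrite -EFinM lee_fin mulr_ge0.
    - apply/measurable_EFinP; apply: measurable_funM => //.
      exact: measurableT_comp.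
  have cv : (fun n => B%:E + K%:E * 'N[P]_2%:E[EFin \o (X \- I n)%R])%E @ \oo --> B%:E.
    rewrite -[X in _ --> X]adde0 -[X in (_ + X)%E](mule0 K%:E).
    by apply: cvgeD => //; [exact: cvg_cst|exact: cvgeZl].
  rewrite -(cvg_lim _ cv) //; apply: lime_ge => //.
  by apply/cvg_ex; exists B%:E.
have nd x : {homo t ^~ x : i j / (i <= j)%N >-> (i <= j)%E}.
  move=> i j ij; rewrite lee_fin lerXn2r ?nnegrE ?le_min ?normr_ge0 ?ler0n //.
  by rewrite ge_min lexx /= ge_min ler_nat ij orbT.
have := @cvg_monotone_convergence _ _ _ P _ measurableT t mt
  (fun j x _ => t0 j x) (fun x _ => nd x).
have -> : (\int[P]_x (fun y => limn (t ^~ y)) x = \int[P]_x (X x ^+ m.*2)%:E)%E.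
  apply: eq_integral => x _; apply/cvg_lim => //.
  (* At each point the truncation is inactive once j >= |X x|. *)
  apply: cvg_near_cst.
  have [j _ hj] := nbhs_infty_ger `|X x|.
  exists j => // k /= jk; rewrite /t; congr EFin.
  by rewrite min_l ?norm_even_power //; exact: hj.
move=> cv; rewrite -(cvg_lim _ cv) //; apply: lime_le.
  by apply/cvg_ex; eexists; exact: cv.
exact: nearW.
Qed.

End moment_limit.

(** * Martingale increments and integrals of step functions *)

Section martingale_transform.
Context d (T : measurableType d) (R : realType) (P : probability T R).
Variables (F : R -> set (set T)) (Z : R -> T -> R).
Hypothesis mart : centered_L2_martingale P F Z.

Lemma martingale_measurable t : 0 <= t -> measurable_fun setT (Z t).
Proof.
case: mart => _ [_ [L2 _]] t0; exact: measurable_fun_Lfun (L2 t t0).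
Qed.

Lemma increment_Lfun2 a c : 0 <= a -> 0 <= c ->
  (fun x => Z c x - Z a x) \in Lfun P 2%:E.
Proof.
case: mart => _ [_ [L2 _]] a0 c0.
have p1 : (1 <= 2%:E :> \bar R)%E by rewrite lee_fin ler1n.
by apply: (@rpredB _ (Lfun P 2%:E)); exact: L2.
Qed.

Lemma increment_integrable a c : 0 <= a -> 0 <= c ->
  P.-integrable setT (EFin \o (fun x => Z c x - Z a x)).
Proof.
move=> a0 c0; apply/Lfun1_integrable; apply: Lfun_subset12.
  exact: fin_num_measure.
exact: increment_Lfun2.
Qed.

(** A centered variable of variance zero vanishes almost surely. This covers the intervals of
    [nu]-measure zero, which the supremum in [lip_norm] leaves out. *)
Lemma increment_null a c : 0 <= a -> 0 <= c -> ('V_P[(Z c \- Z a)%R] = 0)%E ->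
  forall m, (0 < m)%N -> (\int[P]_x ((Z c x - Z a x) ^+ m.*2)%:E = 0)%E.
Proof.
move=> a0 c0 V0 m m0.
have L2 := increment_Lfun2 a0 c0.
have E0 : ('E_P[(Z c \- Z a)%R] = 0)%E.
  case: mart => _ [_ [L2Z [EZ _]]].
  rewrite expectationB; first by rewrite !EZ // sube0.
    by apply: Lfun_subset12; [exact: fin_num_measure|exact: L2Z].
  by apply: Lfun_subset12; [exact: fin_num_measure|exact: L2Z].
have := varianceE L2; rewrite [LHS]V0 E0 expe2 mule0 sube0 unlock => /esym I0.
have mI : measurable_fun setT (fun x => Z c x - Z a x) by exact: measurable_fun_Lfun L2.
have ae0 : ae_eq P setT (fun x => ((Z c x - Z a x) ^+ 2)%:E) (cst 0%E).
  apply/ae_eq_integral_abs => //.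
    by apply/measurable_EFinP; exact: measurable_funX.
  rewrite -[RHS]I0; apply: eq_integral => x _.
  by rewrite gee0_abs // lee_fin sqr_ge0.
transitivity (\int[P]_x (cst 0%E x : \bar R))%E; last by rewrite integral0.
apply: ae_eq_integral => //.
  by apply/measurable_EFinP; exact: measurable_funX.
apply: filterS ae0 => x /(_ I) + _ => -[] /eqP; rewrite sqrf_eq0 => /eqP ->.
by rewrite expr0n double_eq0 eqn0Ngt m0.
Qed.

Section partial_step_integrals.
Variables (tm bv : nat -> R).

Let S n x := \sum_(k < n) bv k * (Z (tm k.+1) x - Z (tm k) x).

(** Only values of Z up to time [tm n] enter the partial sum. Its preimages are thus events on which
    the next increment has mean zero. *)
Lemma partial_step_int_adapted n t : 0 <= tm 0%N ->
  (forall k, (k < n)%N -> tm k < tm k.+1) -> tm n <= t ->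
  measurable_fun setT (S n : g_sigma_algebraType (F t) -> R).
Proof.
move=> tm0 ht tnt.
have [[sF [_ FF]] [aZ _]] := mart.
have tle := increasing_times_le ht.
have mZ k : (k <= n)%N -> measurable_fun setT (Z (tm k) : g_sigma_algebraType (F t) -> R).
  move=> kn; have k0 : 0 <= tm k by apply: le_trans tm0 _; exact: tle.
  have kt : tm k <= t by apply: le_trans tnt; apply: tle; rewrite kn /=.
  apply: (@preimage_measurable_fun _ _ _ (F t) _ (sF _ (le_trans k0 kt))).
  by move=> B mB; apply: (FF _ _ k0 kt); exact: aZ.
apply: measurable_sum => k; apply: measurable_funM => //.
by apply: measurable_funB; apply: mZ => //; exact: ltnW.
Qed.

Lemma partial_step_int_measurable n : 0 <= tm 0%N ->
  (forall k, (k < n)%N -> tm k < tm k.+1) -> measurable_fun setT (S n).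
Proof.
move=> tm0 ht.
have tle := increasing_times_le ht.
have tk0 k : (k <= n)%N -> 0 <= tm k by move=> kn; apply: le_trans tm0 _; exact: tle.
apply: measurable_sum => k; apply: measurable_funM => //.
by apply: measurable_funB; apply: martingale_measurable; apply: tk0 => //; exact: ltnW.
Qed.

Variables (m : nat) (w : R -> R -> R).
Hypotheses (m0 : (0 < m)%N) (w0 : forall a c, 0 <= w a c).
Hypothesis increment_bound : forall a c, 0 <= a -> a < c ->
  (\int[P]_x ((Z c x - Z a x) ^+ m.*2)%:E <= (w a c ^+ m)%:E)%E.

(** Induction on the number of intervals, with the partial sum as X and the next weighted increment
    as Y. Here [w a c] bounds the square of |Z(c) - Z(a)|_2m. *)
Lemma partial_step_int_moment n : 0 <= tm 0%N ->
  (forall k, (k < n)%N -> tm k < tm k.+1) ->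
  (\int[P]_x (S n x ^+ m.*2)%:E <=
   ((2 * m.*2%:R * \sum_(k < n) bv k ^+ 2 * w (tm k) (tm k.+1)) ^+ m)%:E)%E.
Proof.
move=> tm0; elim: n => [|n IHn] ht.
  rewrite [leLHS](_ : _ = 0%E).
    by rewrite lee_fin big_ord0 mulr0 exprn_ge0.
  rewrite -(integral0 P setT); apply: eq_integral => x _.
  by rewrite /S big_ord0 expr0n double_eq0 eqn0Ngt m0.
have htn k : (k < n)%N -> tm k < tm k.+1 by move=> kn; apply: ht; exact: ltnW.
have tle := increasing_times_le ht.
have tn0 : 0 <= tm n by apply: le_trans tm0 _; apply: tle; rewrite leq0n leqnSn.
have tnS : tm n < tm n.+1 by exact: ht.
have tSn0 : 0 <= tm n.+1 by exact: le_trans (ltW tnS).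
have iD := increment_integrable tn0 tSn0.
have mD : measurable_fun setT (fun x => Z (tm n.+1) x - Z (tm n) x).
  by apply/measurable_EFinP; exact: measurable_int iD.
under eq_integral do rewrite /S big_ord_recr /=.
rewrite big_ord_recr /= mulrDr.
apply: even_moment_add_le => //.
- exact: partial_step_int_measurable.
- exact: (integrableZl measurableT _ iD).
- by rewrite !mulr_ge0 // sumr_ge0 // => k _; rewrite mulr_ge0 // sqr_ge0.
- by rewrite mulr_ge0 // sqr_ge0.
- exact: IHn.
- by apply: even_moment_scale => //; exact: increment_bound.
move=> B mB.
have [[sF [Fm _]] [_ [_ [_ orth]]]] := mart.
(* [F (tm n)] is already a sigma-algebra, so the generated one adds no events. *)
have FA : F (tm n) (S n @^-1` B).
  have := partial_step_int_adapted tm0 htn (lexx _) measurableT mB.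
  by rewrite setTI /measurable /= sigma_algebra_id //; exact: sF.
have mA : measurable (S n @^-1` B) by exact: Fm FA.
under eq_integral do rewrite EFinM.
rewrite integralZl //.
  by rewrite (orth _ _ tn0 (ltW tnS) _ FA) mule0.
exact: integrableS iD.
Qed.
End partial_step_integrals.
End martingale_transform.

(** * Squares of step functions and their integrals *)

Section step_functions.
Context {R : realType} (tm bv : nat -> R).

(** The intervals are disjoint, so cross terms vanish: left of [tm n] the last indicator is zero,
    and from [tm n] on all earlier ones are. *)
Lemma partial_step_fun_sqr n s : (forall k, (k < n)%N -> tm k < tm k.+1) ->
  (\sum_(k < n) bv k * \1_([set` `[tm k, tm k.+1[]) s) ^+ 2 =
  \sum_(k < n) bv k ^+ 2 * \1_([set` `[tm k, tm k.+1[]) s.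
Proof.
elim: n => [|n IHn] ht; first by rewrite !big_ord0 expr0n.
have htn k : (k < n)%N -> tm k < tm k.+1 by move=> kn; apply: ht; exact: ltnW.
rewrite !big_ord_recr /= sqrrD IHn // exprMn.
have idem : \1_([set` `[tm n, tm n.+1[]) s ^+ 2 = \1_([set` `[tm n, tm n.+1[]) s :> R.
  by rewrite indicE; case: (_ \in _); rewrite ?expr1n ?expr0n.
rewrite idem [X in _ + X *+ 2 + _](_ : _ = 0) ?mul0rn ?addr0 //.
have [sn|ns] := ltP s (tm n).
  rewrite [X in _ * (_ * X)]indicE memNset ?mulr0 //=.
  by rewrite in_itv /= => /andP[]; rewrite leNgt sn.
rewrite big1 ?mul0r // => k _; rewrite indicE memNset ?mulr0 //=.
rewrite in_itv /= => /andP[_]; rewrite ltNge (le_trans _ ns) //.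
by apply: (increasing_times_le htn); rewrite ltn_ord leqnn.
Qed.

Lemma step_fun_sqr_integral (nu : {measure set R -> \bar R}) K :
  (forall k, (k < K.+1)%N -> tm k < tm k.+1) ->
  (\int[nu]_s (step_fun K tm bv s ^+ 2)%:E =
   \sum_(k < K.+1) (bv k ^+ 2)%:E * nu [set` `[tm k, tm k.+1[])%E.
Proof.
move=> ht.
under eq_integral do rewrite /step_fun partial_step_fun_sqr // -sumEFin.
have mi k : measurable_fun setT (fun s : R => (\1_([set` `[tm k, tm k.+1[]) s : R)%:E).
  by apply/measurable_EFinP; exact: measurable_indic.
rewrite ge0_integral_sum //.
- apply: eq_bigr => k _; under eq_integral do rewrite EFinM.
  rewrite ge0_integralZl_EFin ?sqr_ge0 //.
  by rewrite integral_indic // setIT.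
- move=> k; apply/measurable_EFinP; apply: measurable_funM => //.
- by move=> k s _; rewrite lee_fin mulr_ge0 // sqr_ge0.
Qed.

Lemma step_fun_measurable K : measurable_fun setT (step_fun K tm bv).
Proof.
by apply: measurable_sum => k; apply: measurable_funM => //; exact: measurable_indic.
Qed.

End step_functions.

(** * Weights of the moment norms *)

Section weights.
Context {R : realType}.
Implicit Types q : \bar R.

Lemma psi_weight_gt0 q k : (0 < k)%N -> 0 < psi_weight q k.
Proof. by case: q => [q||] k0 //=; rewrite powR_gt0 // ltr0n. Qed.

Lemma psi_weightM q j k : psi_weight q (j * k) = psi_weight q j * psi_weight q k.
Proof. by case: q => [q||] /=; rewrite ?mulr1 // natrM powRM. Qed.

(** The reciprocal of 2q/(q+2) is 1/q + 1/2; for infinite q the weight of [q] is 1 and only the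
    square root remains. *)
Lemma psi_weight_lip_expo q k : (0 < q)%E -> (0 < k)%N ->
  psi_weight (lip_expo q) k = psi_weight q k / Num.sqrt k%:R.
Proof.
move=> q0 k0; have kR0 : k%:R != 0 :> R by rewrite pnatr_eq0 -lt0n.
rewrite -powR12_sqrt // -powRN.
case: q q0 => [q||] //=; last by rewrite mul1r.
rewrite lte_fin => q0; rewrite -powRD; last by rewrite kR0 implybT.
congr (_ `^ _); have q2 : q + 2 != 0 by rewrite gt_eqF // addr_gt0.
by field; rewrite q2 gt_eqF.
Qed.

End weights.

(** * Moments of increments and the final estimate *)

Lemma lip_norm_increment_moment d (T : measurableType d) (R : realType)
    (P : probability T R) (F : R -> set (set T)) (Z : R -> T -> R)
    (nu : {measure set R -> \bar R}) (q : \bar R) (m : nat) (a c : R) :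
  centered_L2_martingale P F Z ->
  (forall a c, 0 <= a -> a < c -> nu [set` `[a, c[] = ('V_P[(Z c \- Z a)%R])%E) ->
  (lip_norm P nu q Z < +oo)%E -> (0 < m)%N -> 0 <= a -> a < c ->
  (\int[P]_x ((Z c x - Z a x) ^+ m.*2)%:E <=
   (((fine (lip_norm P nu q Z) / psi_weight q m.*2) ^+ 2 *
     fine (nu [set` `[a, c[])) ^+ m)%:E)%E.
Proof.
move=> mart nuV Lfin m0 a0 ac.
set L := lip_norm P nu q Z in Lfin *.
have L0 : (0 <= L)%E by apply: ereal_sup_ubound; left.
have Lfn : L \is a fin_num by rewrite ge0_fin_numE.
have c0 : 0 <= c by exact: le_trans (ltW ac).
have m20 : (0 < m.*2)%N by rewrite double_gt0.
have wgt0 := psi_weight_gt0 q m20.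
have nufin : nu [set` `[a, c[] \is a fin_num.
  by rewrite nuV //; apply: variance_fin_num; exact: (increment_Lfun2 mart).
have [nu0|nu0] := eqVneq (nu [set` `[a, c[]) 0%E.
  rewrite (increment_null mart) // -?nuV // lee_fin exprn_ge0 //.
  by rewrite mulr_ge0 ?sqr_ge0 // fine_ge0.
have nugt0 : (0 < nu [set` `[a, c[])%E by rewrite lt0e nu0 measure_ge0.
set v := fine (nu _).
have v0 : 0 < v by rewrite fine_gt0 // nugt0 ltey_eq nufin.
set r := fine L / psi_weight q m.*2 * Num.sqrt v.
have r0 : 0 <= r by rewrite !mulr_ge0 ?fine_ge0 ?sqrtr_ge0 // invr_ge0 ltW.
have : ('N[P]_(m.*2%:R%:E)[EFin \o (fun x => (Z c x - Z a x)%R)] <= r%:E)%E.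
  (* The interval enters the Lipschitz supremum, and the index 2m alone is then kept from the
     supremum over moments. *)
  have h1 : (psi_norm P q (fun x => (Z c x - Z a x)%R) * ((Num.sqrt v)^-1)%:E <= L)%E.
    apply: ereal_sup_ubound; right; exists a, c; split => //.
    by rewrite ltey_eq nufin.
  rewrite /r EFinM -lee_pdivrMr ?sqrtr_gt0 // EFinM fineK // lee_pdivlMr //.
  apply: le_trans h1.
  rewrite -muleA [X in (_ * X)%E]muleC muleA; apply: lee_wpmul2r.
    by rewrite lee_fin invr_ge0 sqrtr_ge0.
  by apply: ereal_sup_ubound; exists m.*2.
rewrite Lnorm_nat_le //.
under eq_integral do rewrite norm_even_power.
move=> /le_trans; apply.
have <- : r ^+ 2 = (fine L / psi_weight q m.*2) ^+ 2 * v.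
  by rewrite /r exprMn sqr_sqrtr // ltW.
by rewrite lee_fin sqrX_double.
Qed.

Theorem theorem11 (R : realType) (q : \bar R) (q_pos : (0 < q)%E) :
  exists C : R, 0 < C /\
  forall (d : measure_display) (T : measurableType d) (P : probability T R)
    (F : R -> set (set T)) (Z : R -> T -> R) (nu : {measure set R -> \bar R}),
    centered_L2_martingale P F Z ->
    L2_left_continuous P Z ->
    (forall x, Z 0 x = 0) ->
    (forall A, F 0 A -> A = set0 \/ A = setT) ->
    nu [set` `]-oo, 0[] = 0%E ->
    (forall a c, 0 <= a -> a < c -> nu [set` `[a, c[] = ('V_P[(Z c \- Z a)%R])%E) ->
    (lip_norm P nu q Z < +oo)%E ->
    forall (b : R -> R) (X : T -> R),
      b \in Lfun nu 2%:E ->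
      is_stoch_integral P nu Z b X ->
      (psi_norm P (lip_expo q) X
         <= C%:E * 'N[nu]_2%:E[EFin \o b] * lip_norm P nu q Z)%E.
Proof.
have w2 := psi_weight_gt0 q (isT : (0 < 2)%N).
(* This is 2 * 2^(1/q): the factor 2 comes from sqrt(2 * 2k) = 2 sqrt(k), and 2^(1/q) from using
   moments of order 2k to bound those of order k. *)
exists (2 / psi_weight q 2); split; first by rewrite divr_gt0.
move=> d T P F Z nu mart _ _ _ _ nuV Lfin b X b2 [X2 [K [tm [bv [ht [bI XI]]]]]].
have mb := measurable_fun_Lfun b2.
have mX := measurable_fun_Lfun X2.
have L0 : (0 <= lip_norm P nu q Z)%E by apply: ereal_sup_ubound; left.
have Lfn : lip_norm P nu q Z \is a fin_num by rewrite ge0_fin_numE.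
have incr := lip_norm_increment_moment mart nuV Lfin.
rewrite -(fineK Lfn).
set L := fine _ in incr *; have {}L0 : 0 <= L by exact: fine_ge0.
have Nb0 := Lnorm_ge0 nu 2%:E (EFin \o b).
have Nbfn : 'N[nu]_2%:E[EFin \o b]%E \is a fin_num.
  by rewrite ge0_fin_numE //; move: b2; rewrite inE => /andP[_]; rewrite inE.
rewrite -(fineK Nbfn).
set be := fine 'N[nu]_2%:E[_]%E; have be0 : 0 <= be by exact: fine_ge0.
have nufin a c : 0 <= a -> a < c -> nu [set` `[a, c[] \is a fin_num.
  move=> a0 ac; rewrite nuV //; apply: variance_fin_num.
  by apply: (increment_Lfun2 mart) => //; exact: le_trans (ltW ac).
apply: ge_ereal_sup => _ [k /= k0 <-].
have k20 : (0 < k.*2)%N by rewrite double_gt0.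
have wk := psi_weight_gt0 q k20.
set C := 2 / _; have C0 : 0 < C by rewrite divr_gt0.
have sk0 : 0 < Num.sqrt k%:R :> R by rewrite sqrtr_gt0 ltr0n.
(* c is L (2k)^(1/q), the factor between |Z(t) - Z(s)|_2k and the square root of nu([s,t)). *)
have [c cE] : exists c, c = L / psi_weight q k.*2 by eexists.
have c0 : 0 <= c by rewrite cE divr_ge0 // ltW.
(* The slack e absorbs the distance from b to an approximating step function. *)
have bound e : 0 < e ->
    ('N[P]_(k%:R%:E)[EFin \o X] <= (2 * Num.sqrt k%:R * (c * (be + e)))%:E)%E.
  move=> e0; pose B := 2 * k.*2%:R * (c * (be + e)) ^+ 2.
  have bee : 0 <= be + e by rewrite addr_ge0 // ltW.
  have k40 : 0 <= 2 * k.*2%:R :> R by rewrite mulr_ge0 ?ler0n.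
  have B0 : 0 <= B by apply: mulr_ge0 => //; exact: sqr_ge0.
  have -> : 2 * Num.sqrt k%:R * (c * (be + e)) = Num.sqrt B.
    have s0 : 0 <= 2 * Num.sqrt k%:R * (c * (be + e)) by rewrite !mulr_ge0 ?sqrtr_ge0.
    rewrite -[LHS]ger0_norm // -sqrtr_sqr; congr Num.sqrt.
    rewrite /B [LHS]exprMn [in LHS]exprMn sqr_sqrtr // -muln2 natrM; ring.
  apply: Lnorm_nat_double => //.
  apply: (even_moment_lim mX _ XI) => [n|].
    case: (ht n) => tm0 tmlt.
    by apply: (partial_step_int_measurable mart).
  have near_b : \forall n \near \oo,
      ('N[nu]_2%:E[EFin \o (b \- step_fun (K n) (tm n) (bv n))%R] < e%:E)%E.
    exact: (bI _ (@nbhs_open_ereal_lt _ 0 (fun=> e) e0)).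
  apply: filterS near_b => n bn.
  case: (ht n) => tm0 tmlt.
  have {}tmlt : forall j, (j < (K n).+1)%N -> tm n j < tm n j.+1 by exact: tmlt.
  have mstep := step_fun_measurable (tm n) (bv n) (K n).
  have Ns : ('N[nu]_2%:E[EFin \o step_fun (K n) (tm n) (bv n)] <= (be + e)%:E)%E.
    have mbs : measurable_fun setT (b \- step_fun (K n) (tm n) (bv n))%R.
      exact: measurable_funB.
    have two1 : 1 <= 2 :> R by rewrite ler1n.
    apply: le_trans (lerB_DLnorm nu mstep mbs two1) _.
    rewrite [leRHS]EFinD; apply: leeD; last exact: ltW.
    rewrite /be fineK // le_eqVlt; apply/orP; left; apply/eqP.
    by apply: eq_Lnorm => x /=; congr EFin; rewrite /= addrC subrK.
  pose w a c' := c ^+ 2 * fine (nu [set` `[a, c'[]).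
  have w0 a c' : 0 <= w a c'.
    by apply: mulr_ge0; [exact: sqr_ge0|exact: fine_ge0].
  have incr_w a c' : 0 <= a -> a < c' ->
      (\int[P]_x ((Z c' x - Z a x) ^+ k.*2)%:E <= (w a c' ^+ k)%:E)%E.
    by move=> a0 ac; rewrite /w cE; exact: incr.
  have := partial_step_int_moment mart (bv n) k0 w0 incr_w tm0 tmlt.
  move=> /le_trans; apply.
  rewrite lee_fin lerXn2r ?nnegrE //.
    apply: mulr_ge0 => //; apply: sumr_ge0 => i _.
    by apply: mulr_ge0 => //; exact: sqr_ge0.
  rewrite /B ler_wpM2l // exprMn.
  under eq_bigr do rewrite /w mulrCA.
  rewrite -mulr_sumr ler_wpM2l ?sqr_ge0 //.
  move: Ns; rewrite (@Lnorm_nat_le _ _ _ nu _ 2) //.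
  under eq_integral do rewrite real_normK ?num_real //.
  rewrite step_fun_sqr_integral // => Ns.
  rewrite -lee_fin; apply: le_trans Ns.
  rewrite -sumEFin le_eqVlt; apply/orP; left; apply/eqP.
  apply: eq_bigr => i _; rewrite EFinM fineK //; apply: nufin.
    apply: le_trans tm0 _; apply: (increasing_times_le tmlt).
    by rewrite leq0n ltnW.
  exact: tmlt.
rewrite -!EFinM; apply/lee_addgt0Pr => e e0.
(* The added 1 keeps the divisor positive when L = 0; with slack e / D the excess C L e / D is at
   most e. *)
pose D := C * L + 1.
have D0 : 0 < D by rewrite ltr_wpDl // mulr_ge0 // ltW.
have w0 : 0 <= psi_weight (lip_expo q) k by rewrite ltW // psi_weight_gt0.
apply: le_trans (lee_wpmul2r _ (bound (e / D) (divr_gt0 e0 D0))) _.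
  by rewrite lee_fin.
rewrite -EFinM -EFinD lee_fin psi_weight_lip_expo // cE -mul2n psi_weightM.
have wk1 := psi_weight_gt0 q k0.
(* All dependence on k cancels: sqrt(k) and the weight of k both occur once above and once below. *)
rewrite [leLHS](_ : _ = C * be * L + C * L * (e / D)); last first.
  by rewrite /C; field; rewrite !gt_eqF.
rewrite lerD2l mulrCA -[leRHS]mulr1; apply: ler_wpM2l; first exact: ltW.
by rewrite ler_pdivrMr // mul1r lerDl.
Qed.
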